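(* Let $\mathrm{Thin}^*$ be the functor from dg box operads to nonsymmetric dg operads given by $\mathrm{Thin}^*(B)(q)=B(0,q,0)$, and let $\mathrm{Thin}_!$ be its left adjoint, given by $\mathrm{Thin}_!(\mathcal P)(0,q,0)=\mathcal P(q)$ and $\mathrm{Thin}_!(\mathcal P)(p,q,r)=0$ if $(p,r)\ne(0,0)$. Then: (1) $\mathrm{Thin}^*\circ\mathrm{Thin}_!$ is the identity functor of the category of nonsymmetric dg operads; (2) $\mathrm{Thin}_!$ embeds the category of nonsymmetric dg operads as a coreflective subcategory of the category of dg box operads.
   Context: $k$ is a field of characteristic $0$; dg modules are chain complexes over $k$, with Koszul signs. A dg box operad $B$ is a family $(B(p,q,r))_{p,q,r\in\mathbb N}$ of dg $k$-modules with composition chain maps $\mu:B(p,n,r)\otimes\bigotimes_{i=1}^n B(p_{i-1},q_i,p_i)\to B(p+p_0,\sum_i q_i,r+p_n)$ for all $n\ge 0$ and all indices (for $n=0$: a map $\mu_{p_0}:B(p,0,r)\to B(p+p_0,0,r+p_0)$ for every $p_0\ge0$) and a unit $1\in B(0,1,0)$, such that $\mu(x;\mu(x_1;x^1_1,\dots),\dots,\mu(x_n;x^n_1,\dots))=\pm\mu(\mu(x;x_1,\dots,x_n);x_1^1,\dots)$ (Koszul sign) whenever arities match, and $\mu(x;1,\dots,1)=x=\mu(1;x)$. A morphism is a family of chain maps commuting with compositions and units. The operad structure on $\mathrm{Thin}^*(B)$ is the restriction of $\mu$ to the arities $(0,q,0)$ (all $p$'s and $r$'s equal to $0$); the box operad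 structure on $\mathrm{Thin}_!(\mathcal P)$ is the operad composition in those arities and zero otherwise. A coreflective subcategory is a full subcategory whose inclusion has a right adjoint.
   Formalization: Thin_! is taken to be the functor given by the explicit formula; that it is left adjoint to Thin^* is not asserted, since this fails when P(0) ≠ 0 (compositions with n = 0); in (2) the inclusion's right adjoint exists but is not identified with Thin^*. *)

(* Defs.v *)
From HB Require Import structures.
From mathcomp Require Import all_boot all_order all_algebra.
From mathcomp Require Import boolp.

Set Implicit Arguments.
Unset Strict Implicit.
Unset Printing Implicit Defensive.

Import GRing.Theory.
Local Open Scope ring_scope.

(** * Categories *)

Record category := Category {
  ob :> Type;
  mor : ob -> ob -> Type;
  idm : forall X, mor X X;
  mcomp : forall X Y Z, mor Y Z -> mor X Y -> mor X Z;
  comp1m : forall X Y (f : mor X Y), mcomp (idm Y) f = f;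
  compm1 : forall X Y (f : mor X Y), mcomp f (idm X) = f;
  compmA : forall X Y Z W (f : mor Z W) (g : mor Y Z) (h : mor X Y),
    mcomp f (mcomp g h) = mcomp (mcomp f g) h }.

Arguments idm {_} _.

Record functor (C D : category) := Functor {
  fob :> C -> D;
  fmap : forall X Y, mor X Y -> mor (fob X) (fob Y);
  fmap1 : forall X, fmap (idm X) = idm (fob X);
  fmapM : forall X Y Z (f : mor Y Z) (g : mor X Y),
    fmap (mcomp f g) = mcomp (fmap f) (fmap g) }.

Arguments fmap {C D} _ {X Y} _.

Definition functor_id (C : category) : functor C C :=
  @Functor C C (fun X => X) (fun _ _ f => f) (fun _ => erefl)
    (fun _ _ _ _ _ => erefl).

Section FunctorComp.
Variables (C D E : category) (G : functor D E) (F : functor C D).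

Lemma functor_comp1 X : fmap G (fmap F (idm X)) = idm (G (F X)).
Proof. by rewrite !fmap1. Qed.

Lemma functor_compM X Y Z (f : mor Y Z) (g : mor X Y) :
  fmap G (fmap F (mcomp f g)) = mcomp (fmap G (fmap F f)) (fmap G (fmap F g)).
Proof. by rewrite !fmapM. Qed.

Definition functor_comp : functor C E :=
  @Functor C E (fun X => G (F X)) (fun _ _ f => fmap G (fmap F f))
    functor_comp1 functor_compM.
End FunctorComp.

Definition is_right_adjoint (C D : category) (F : functor C D)
    (G : functor D C) : Prop :=
  exists phi : forall X Y, mor (F X) Y -> mor X (G Y),
    [/\ forall X Y, bijective (phi X Y),
        forall X X' Y (f : mor X' X) (h : mor (F X) Y),
          phi X' Y (mcomp h (fmap F f)) = mcomp (phi X Y h) f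
      & forall X Y Y' (g : mor Y Y') (h : mor (F X) Y),
          phi X Y' (mcomp g h) = mcomp (fmap G g) (phi X Y h)].

Definition full_subcat (D : category) (S : D -> Prop) : category :=
  @Category {Y : D | S Y} (fun Y Z => mor (sval Y) (sval Z))
    (fun Y => idm (sval Y)) (fun _ _ _ f g => mcomp f g)
    (fun _ _ f => comp1m f) (fun _ _ f => compm1 f)
    (fun _ _ _ _ f g h => compmA f g h).

Definition full_incl (D : category) (S : D -> Prop) :
    functor (full_subcat S) D :=
  @Functor (full_subcat S) D (fun Y => sval Y) (fun _ _ f => f)
    (fun _ => erefl) (fun _ _ _ _ _ => erefl).

Definition coreflective (D : category) (S : D -> Prop) : Prop :=
  exists R : functor D (full_subcat S), is_right_adjoint (full_incl S) R.

(** [F] is an isomorphism of [C] onto a full subcategory of [D], namely the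
    full subcategory on the objects [F X], and this one is coreflective. *)
Definition embeds_as_coreflective (C D : category) (F : functor C D) : Prop :=
  [/\ injective (fob F),
      forall X Y, bijective (@fmap C D F X Y)
    & coreflective (fun Y => exists X, F X = Y)].

(** * Dg modules *)

Section DgModules.
Variable k : fieldType.

Record dgmod := DgMod {
  dg_mod :> int -> lmodType k;
  dg_d : forall a, {linear dg_mod a -> dg_mod (a - 1)};
  dg_dd : forall a (x : dg_mod a), dg_d (a - 1) (dg_d a x) = 0 }.

Definition dg_cast (M : dgmod) a b (e : a = b) (x : M a) : M b :=
  ecast c (M c) e x.

Definition dg0 : dgmod :=
  @DgMod (fun=> 'rV[k]_0) (fun=> \0) (fun=> fun=> erefl).

(** A degree 0 map [M0 (x) M_1 (x) ... (x) M_n -> N], given on tuples of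
    homogeneous elements of arbitrary degrees [a], [b i]. *)
Definition mmap n (M0 : dgmod) (M : 'I_n -> dgmod) (N : dgmod) :=
  forall (a : int) (b : 'I_n -> int),
    M0 a -> (forall i, M i (b i)) -> N (a + \sum_i b i).

(** [xs] with the differential applied in position [i] only. *)
Definition d_at n (M : 'I_n -> dgmod) (b : 'I_n -> int) (i : 'I_n)
    (xs : forall j, M j (b j)) : forall j, M j (b j - (j == i)%:R) :=
  fun j => match j == i as c return M j (b j - c%:R) with
           | true => dg_d (M j) (b j) (xs j)
           | false => dg_cast (esym (subr0 (b j))) (xs j)
           end.

Lemma deg_d0 (a s : int) : (a - 1) + s = (a + s) - 1.
Proof. by rewrite addrAC. Qed.

Lemma deg_di n (a : int) (b : 'I_n -> int) (i : 'I_n) :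
  a + \sum_j (b j - (j == i)%:R) = (a + \sum_j b j) - 1.
Proof.
rewrite sumrB addrA; congr (_ - _).
by rewrite (bigD1 i) //= eqxx big1 ?addr0 // => j /negbTE ->.
Qed.

(** [mu] is multilinear and commutes with the differentials, the differential
    of the tensor product carrying the Koszul signs; that is, [mu] is a chain
    map on the tensor product. *)
Record chain_mmap n M0 (M : 'I_n -> dgmod) N (mu : mmap M0 M N) : Prop := {
  mmap_linear0 : forall a b (xs : forall i, M i (b i)),
    linear (fun x : M0 a => mu a b x xs);
  mmap_linear : forall a b (x : M0 a) (xs ys zs : forall i, M i (b i)) (i : 'I_n) c,
    (forall j, j != i -> xs j = zs j /\ ys j = zs j) ->
    zs i = c *: xs i + ys i ->
    mu a b x zs = c *: mu a b x xs + mu a b x ys;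
  mmap_d : forall a b (x : M0 a) (xs : forall i, M i (b i)),
    dg_d N _ (mu a b x xs) =
      dg_cast (deg_d0 a _) (mu _ b (dg_d M0 a x) xs)
      + \sum_(i < n) (-1) ^ (a + \sum_(j < n | (j < i)%N) b j)
          *: dg_cast (deg_di a b i) (mu a _ x (d_at i xs)) }.

(** Koszul sign of the shuffle from [x_1, z_1*, ..., x_n, z_n*] to
    [x_1, ..., x_n, z_1*, ..., z_n*], where [b] gives the degrees of the [x_i]
    and [c] those of the [z_ij], listed lexicographically. *)
Definition shuffle_sign n (qs : 'I_n -> nat) (b : 'I_n -> int)
    (c : 'I_(\sum_i qs i)%N -> int) : k :=
  (-1) ^ (\sum_(i < n) \sum_(j < n | (i < j)%N) b j * \sum_l c (tagnat.Rank i l)).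

End DgModules.

Arguments dg_d {k} _ {a}.
Arguments shuffle_sign k {n qs} b c.

(** * Nonsymmetric dg operads *)

Section Operads.
Variable k : fieldType.

Inductive op_eq (P : nat -> dgmod k) q a (x : P q a) :
  forall q' a', P q' a' -> Prop := OpEq : op_eq x x.

(** The inputs [z] of the outer composite are numbered lexicographically:
    [z (tagnat.Rank i j)] is the [j]-th input of [xs i]. *)
Record nsop := NsOp {
  ns_mod :> nat -> dgmod k;
  ns_mu : forall n (qs : 'I_n -> nat),
    mmap (ns_mod n) (fun i => ns_mod (qs i)) (ns_mod (\sum_i qs i)%N);
  ns_one : ns_mod 1 0;
  ns_muP : forall n (qs : 'I_n -> nat), chain_mmap (@ns_mu n qs);
  ns_d1 : dg_d _ ns_one = 0;
  ns_mu1x : forall (qs : 'I_1 -> nat) b (xs : forall i, ns_mod (qs i) (b i)),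
    op_eq (ns_mu ns_one xs) (xs ord0);
  ns_mux1 : forall n a (x : ns_mod n a),
    op_eq (ns_mu x (fun _ : 'I_n => ns_one)) x;
  ns_muA : forall n (qs : 'I_n -> nat) a b
      (x : ns_mod n a) (xs : forall i, ns_mod (qs i) (b i))
      (w : 'I_(\sum_i qs i)%N -> nat) c (z : forall l, ns_mod (w l) (c l)),
    op_eq (ns_mu x (fun i => ns_mu (xs i) (fun j => z (tagnat.Rank i j))))
          (shuffle_sign k b c *: ns_mu (ns_mu x xs) z) }.

Record nsop_mor (P Q : nsop) := NsOpMor {
  nsm :> forall q a, P q a -> Q q a;
  nsm_linear : forall q a, linear (@nsm q a);
  nsm_d : forall q a (x : P q a), nsm (dg_d _ x) = dg_d _ (nsm x);
  nsm_mu : forall n (qs : 'I_n -> nat) a b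
      (x : P n a) (xs : forall i, P (qs i) (b i)),
    nsm (ns_mu x xs) = ns_mu (nsm x) (fun i => nsm (xs i));
  nsm_one : nsm (ns_one P) = ns_one Q }.

Lemma nsop_mor_eq P Q (f g : nsop_mor P Q) :
  (forall q a (x : P q a), f q a x = g q a x) -> f = g.
Proof.
case: f g => [f f1 f2 f3 f4] [g g1 g2 g3 g4] /= fg.
have {}fg : f = g.
  by do 3!apply: functional_extensionality_dep => ?; exact: fg.
by rewrite {}fg in f1 f2 f3 f4 *; congr NsOpMor; exact: Prop_irrelevance.
Qed.

Definition nsop_idm P : nsop_mor P P.
Proof. by exists (fun _ _ x => x). Defined.

Definition nsop_comp P Q R (f : nsop_mor Q R) (g : nsop_mor P Q) :
  nsop_mor P R.
Proof.
exists (fun q a x => f q a (g q a x)).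
- by move=> q a c x y; rewrite !nsm_linear.
- by move=> q a x; rewrite !nsm_d.
- by move=> n qs a b x xs; rewrite !nsm_mu.
- by rewrite !nsm_one.
Defined.

Definition nsop_cat : category.
Proof.
by exists nsop nsop_mor nsop_idm nsop_comp => *; exact: nsop_mor_eq.
Defined.

End Operads.

(** * Dg box operads *)

Section BoxOperads.
Variable k : fieldType.

(** Of the colours [p_0, ..., p_n], those at [lo i] and [hi i] are the first
    and third arities of the input in position [i]. *)
Definition lo n (i : 'I_n) : 'I_n.+1 := widen_ord (leqnSn n) i.
Definition hi n (i : 'I_n) : 'I_n.+1 := lift ord0 i.

(** With [\sum_i qs i] elements cut into consecutive blocks of sizes [qs i],
    [cut qs i j] is the position separating the first [j] elements of block [i]
    from the others; [i = n] (and [j = 0]) is allowed. *)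
Definition cut n (qs : 'I_n -> nat) (i j : nat) : 'I_(\sum_i qs i).+1 :=
  inord ((\sum_(l < n | l < i) qs l) + j)%N.

Inductive bx_eq (B : nat -> nat -> nat -> dgmod k) p q r a (x : B p q r a) :
  forall p' q' r' a', B p' q' r' a' -> Prop := BxEq : bx_eq x x.

(** In [bx_muA], [z] is the list of all inputs of the outer composite, with
    colours [t]; [zb i] is its [i]-th block and [ys i] is the composite of
    [xs i] with [zb i].  The equalities [bx_eq] account for the arities and
    degrees that are equal only propositionally.  *)
Record boxop := BoxOp {
  bx_mod :> nat -> nat -> nat -> dgmod k;
  bx_mu : forall p n r (ps : 'I_n.+1 -> nat) (qs : 'I_n -> nat),
    mmap (bx_mod p n r) (fun i => bx_mod (ps (lo i)) (qs i) (ps (hi i)))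
      (bx_mod (p + ps ord0)%N (\sum_i qs i)%N (r + ps ord_max)%N);
  bx_one : bx_mod 0 1 0 0;
  bx_muP : forall p n r (ps : 'I_n.+1 -> nat) (qs : 'I_n -> nat),
    chain_mmap (@bx_mu p n r ps qs);
  bx_d1 : dg_d _ bx_one = 0;
  bx_mu1x : forall (ps : 'I_2 -> nat) (qs : 'I_1 -> nat) b
      (xs : forall i, bx_mod (ps (lo i)) (qs i) (ps (hi i)) (b i)),
    bx_eq (bx_mu bx_one xs) (xs ord0);
  bx_mux1 : forall p n r a (x : bx_mod p n r a),
    bx_eq (@bx_mu p n r (fun=> 0%N) (fun=> 1%N) a (fun=> 0)
             x (fun _ : 'I_n => bx_one)) x;
  bx_muA : forall p n r (ps : 'I_n.+1 -> nat) (qs : 'I_n -> nat) a b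
      (x : bx_mod p n r a)
      (xs : forall i, bx_mod (ps (lo i)) (qs i) (ps (hi i)) (b i))
      (t : 'I_(\sum_i qs i).+1 -> nat) (w : 'I_(\sum_i qs i)%N -> nat) c
      (z : forall l, bx_mod (t (lo l)) (w l) (t (hi l)) (c l))
      (zb : forall i (j : 'I_(qs i)),
        bx_mod (t (cut qs i (lo j))) (w (tagnat.Rank i j))
               (t (cut qs i (hi j))) (c (tagnat.Rank i j)))
      (T := fun i : 'I_n.+1 => (ps i + t (cut qs i 0))%N)
      (ys : forall i, bx_mod (T (lo i)) (\sum_j w (tagnat.Rank i j))%N
                        (T (hi i)) (b i + \sum_j c (tagnat.Rank i j))),
    (forall i j, bx_eq (zb i j) (z (tagnat.Rank i j))) ->
    (forall i, bx_eq (ys i)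
       (@bx_mu _ _ _ (fun j : 'I_(qs i).+1 => t (cut qs i j)) _ _ _
          (xs i) (zb i))) ->
    bx_eq (bx_mu x ys) (shuffle_sign k b c *: bx_mu (bx_mu x xs) z) }.

Record boxop_mor (B C : boxop) := BoxOpMor {
  bxm :> forall p q r a, B p q r a -> C p q r a;
  bxm_linear : forall p q r a, linear (@bxm p q r a);
  bxm_d : forall p q r a (x : B p q r a), bxm (dg_d _ x) = dg_d _ (bxm x);
  bxm_mu : forall p n r (ps : 'I_n.+1 -> nat) (qs : 'I_n -> nat) a b
      (x : B p n r a) (xs : forall i, B (ps (lo i)) (qs i) (ps (hi i)) (b i)),
    bxm (bx_mu x xs) = bx_mu (bxm x) (fun i => bxm (xs i));
  bxm_one : bxm (bx_one B) = bx_one C }.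

Lemma boxop_mor_eq B C (f g : boxop_mor B C) :
  (forall p q r a (x : B p q r a), f p q r a x = g p q r a x) -> f = g.
Proof.
case: f g => [f f1 f2 f3 f4] [g g1 g2 g3 g4] /= fg.
have {}fg : f = g.
  by do 5!apply: functional_extensionality_dep => ?; exact: fg.
by rewrite {}fg in f1 f2 f3 f4 *; congr BoxOpMor; exact: Prop_irrelevance.
Qed.

Definition boxop_idm B : boxop_mor B B.
Proof. by exists (fun _ _ _ _ x => x). Defined.

Definition boxop_comp B C D (f : boxop_mor C D) (g : boxop_mor B C) :
  boxop_mor B D.
Proof.
exists (fun p q r a x => f p q r a (g p q r a x)).
- by move=> p q r a c x y; rewrite !bxm_linear.
- by move=> p q r a x; rewrite !bxm_d.
- by move=> p n r ps qs a b x xs; rewrite !bxm_mu.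
- by rewrite !bxm_one.
Defined.

Definition boxop_cat : category.
Proof.
by exists boxop boxop_mor boxop_idm boxop_comp => *; exact: boxop_mor_eq.
Defined.

End BoxOperads.

(** * The functors between nonsymmetric dg operads and dg box operads *)

Section ThinStar.
Variable k : fieldType.
Local Notation nsop := (nsop k).
Local Notation boxop := (boxop k).

Lemma bx_opE (B : boxop) q a (x : B 0%N q 0%N a) q' a' (y : B 0%N q' 0%N a') :
  bx_eq x y -> @op_eq k (fun q => B 0%N q 0%N) q a x q' a' y.
Proof.
pose F := fun q => B 0%N q 0%N.
pose R p q' r a' : B p q' r a' -> Prop :=
  match p, r return B p q' r a' -> Prop with
  | 0, 0 => fun y => @op_eq k F q a x q' a' y
  | _, _ => fun=> True
  end.
by move=> xy; exact: (@bx_eq_ind k B _ q _ a x R (OpEq _) _ _ _ _ _ xy).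
Qed.

Definition thin_star_ob (B : boxop) : nsop.
Proof.
exists (fun q => B 0%N q 0%N)
  (fun n qs => @bx_mu k B 0%N n 0%N (fun=> 0%N) qs) (bx_one B).
- by move=> n qs; exact: bx_muP.
- exact: bx_d1.
- by move=> qs b xs; apply: bx_opE; exact: (@bx_mu1x k B (fun=> 0%N)).
- by move=> n a x; apply: bx_opE; exact: (@bx_mux1 k B 0%N n 0%N a x).
- move=> n qs a b x xs w c z; apply: bx_opE.
  exact: (@bx_muA k B 0%N n 0%N (fun=> 0%N) qs a b x xs (fun=> 0%N) w c z
    (fun i j => z (tagnat.Rank i j))).
Defined.

Definition thin_star_mor (B C : boxop) (f : boxop_mor B C) :
  nsop_mor (thin_star_ob B) (thin_star_ob C).
Proof.
exists (fun q a => f 0%N q 0%N a).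
- by move=> q a; exact: bxm_linear.
- by move=> q a x; exact: bxm_d.
- by move=> n qs a b x xs; exact: (@bxm_mu k B C f 0%N n 0%N (fun=> 0%N) qs a b x xs).
- exact: bxm_one.
Defined.

Definition thin_star : functor (boxop_cat k) (nsop_cat k).
Proof.
by exists thin_star_ob thin_star_mor => *; exact: nsop_mor_eq.
Defined.

End ThinStar.

Section ThinShriek.
Variables (k : fieldType) (P : nsop k).

Definition shriek_mod (p q r : nat) : dgmod k :=
  match p, r with 0, 0 => P q | _, _ => dg0 k end.

Definition shriek_ext p q r a : shriek_mod p q r a -> P q a :=
  match p, r return shriek_mod p q r a -> P q a with
  | 0, 0 => fun x => x | _, _ => fun=> 0 end.

Definition shriek_ins p q r a : P q a -> shriek_mod p q r a :=
  match p, r return P q a -> shriek_mod p q r a with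
  | 0, 0 => fun x => x | _, _ => fun=> 0 end.

Definition shriek_mu p n r (ps : 'I_n.+1 -> nat) (qs : 'I_n -> nat) :
    mmap (shriek_mod p n r)
      (fun i => shriek_mod (ps (lo i)) (qs i) (ps (hi i)))
      (shriek_mod (p + ps ord0) (\sum_i qs i) (r + ps ord_max)) :=
  fun a b x xs =>
    shriek_ins _ _ (ns_mu (shriek_ext x) (fun i => shriek_ext (xs i))).

Arguments shriek_mu {p n r ps qs a b} x xs.

Lemma shriek_ext_linear p q r a : linear (@shriek_ext p q r a).
Proof.
case: p r => [|p] [|r] c x y //=; by rewrite scaler0 addr0.
Qed.

Lemma shriek_ins_linear p q r a : linear (@shriek_ins p q r a).
Proof.
case: p r => [|p] [|r] c x y //=; by rewrite scaler0 addr0.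
Qed.

Lemma shriek_ext_d p q r a (x : shriek_mod p q r a) :
  shriek_ext (dg_d _ x) = dg_d _ (shriek_ext x).
Proof. by case: p r x => [|p] [|r] x //=; rewrite linear0. Qed.

Lemma shriek_ins_d p q r a (x : P q a) :
  shriek_ins p r (dg_d _ x) = dg_d _ (shriek_ins p r x).
Proof. by case: p r => [|p] [|r]. Qed.

Lemma shriek_ext_cast p q r a a' (e : a = a') (x : shriek_mod p q r a) :
  shriek_ext (dg_cast e x) = dg_cast e (shriek_ext x).
Proof. by case: a' / e. Qed.

Lemma shriek_ins_cast p q r a a' (e : a = a') (x : P q a) :
  shriek_ins p r (dg_cast e x) = dg_cast e (shriek_ins p r x).
Proof. by case: a' / e. Qed.

Lemma shriek_insZ p q r a c (x : P q a) :
  shriek_ins p r (c *: x) = c *: shriek_ins p r x.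
Proof. by case: p r => [|p] [|r] //=; rewrite scaler0. Qed.

Lemma shriek_insD p q r a (x y : P q a) :
  shriek_ins p r (x + y) = shriek_ins p r x + shriek_ins p r y.
Proof. by case: p r => [|p] [|r] //=; rewrite addr0. Qed.

Lemma shriek_ins0 p q r a : shriek_ins p r (0 : P q a) = 0.
Proof. by case: p r => [|p] [|r]. Qed.

Lemma shriek_ext0 p q r a (x : shriek_mod p q r a) :
  (0 < p + r)%N -> shriek_ext x = 0.
Proof. by case: p r x => [|p] [|r]. Qed.

Lemma shriek_muP p n r (ps : 'I_n.+1 -> nat) (qs : 'I_n -> nat) :
  chain_mmap (@shriek_mu p n r ps qs).
Proof.
have [lin0 lini dif] := ns_muP P qs.
split.
- by move=> a b xs c x y; rewrite /shriek_mu shriek_ext_linear lin0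
    shriek_ins_linear.
- move=> a b x xs ys zs i c xyz zsi.
  rewrite /shriek_mu -shriek_ins_linear; congr shriek_ins.
  apply: lini (i) _ _ _ => [j /xyz [-> ->] //|].
  by rewrite zsi shriek_ext_linear.
- move=> a b x xs; rewrite /shriek_mu -shriek_ins_d dif shriek_insD.
  rewrite shriek_ins_cast -shriek_ext_d; congr (_ + _).
  rewrite (big_morph _ (@shriek_insD _ _ _ _) (@shriek_ins0 _ _ _ _)).
  apply: eq_bigr => i _.
  rewrite shriek_insZ shriek_ins_cast; congr (_ *: dg_cast _ (shriek_ins _ _ _)).
  congr ns_mu; apply: functional_extensionality_dep => j; rewrite /d_at.
  by case: eqP => _; rewrite ?shriek_ext_d ?shriek_ext_cast.
Qed.

Lemma op_eq_shriek p p' r r' q a (x : P q a) q' a' (y : P q' a') :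
  p = p' -> r = r' -> op_eq x y ->
  bx_eq (B := shriek_mod) (shriek_ins p r x) (shriek_ins p' r' y).
Proof. by move=> <- <- xy; case: _ _ _ / xy. Qed.

Lemma bx_eq_shriek p q r a (x : shriek_mod p q r a)
    p' q' r' a' (y : shriek_mod p' q' r' a') :
  bx_eq x y -> op_eq (shriek_ext x) (shriek_ext y).
Proof. by move=> xy; case: _ _ _ _ _ / xy. Qed.

Lemma op_eqE q a (x y : P q a) : op_eq x y -> x = y.
Proof.
pose R q' a' (y : P q' a') :=
  forall (eq : q' = q) (ea : a' = a), ecast q (P q a) eq (dg_cast ea y) = x.
move=> xy; suff: R _ _ y by move/(_ erefl erefl) => /= ->.
case: _ _ _ / xy => eq ea.
by rewrite (eq_irrelevance eq erefl) (eq_irrelevance ea erefl).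
Qed.

Lemma ns_mu0l n (qs : 'I_n -> nat) a b (x : P n a)
  (xs : forall i, P (qs i) (b i)) : x = 0 -> ns_mu x xs = 0.
Proof.
move=> ->; have [lin0 _ _] := ns_muP P qs.
have /= := lin0 a b xs (-1) 0 0.
by rewrite scaler0 addr0 scaleN1r addNr.
Qed.

Lemma ns_mu0 n (qs : 'I_n -> nat) a b (x : P n a)
  (xs : forall i, P (qs i) (b i)) i : xs i = 0 -> ns_mu x xs = 0.
Proof.
move=> xi0; have [_ lini _] := ns_muP P qs.
have := @lini a b x xs xs xs i (-1) (fun _ _ => conj erefl erefl).
by rewrite xi0 scaler0 addr0 scaleN1r addNr => /(_ erefl).
Qed.

Lemma cut_first n (qs : 'I_n -> nat) : cut qs 0 0 = ord0.
Proof.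
have s0 : (\sum_(l < n | l < 0) qs l = 0)%N by rewrite big_pred0.
by apply: val_inj; apply: etrans (inordK _) _; rewrite s0.
Qed.

Lemma cut_last n (qs : 'I_n -> nat) : cut qs n 0 = ord_max.
Proof.
have sn : (\sum_(l < n | l < n) qs l = \sum_i qs i)%N.
  by apply: eq_bigl => l; rewrite ltn_ord.
by apply: val_inj; apply: etrans (inordK _) _; rewrite sn addn0.
Qed.

Lemma shriek_extK p q r a (x : P q a) :
  p = 0%N -> r = 0%N -> shriek_ext (shriek_ins p r x) = x.
Proof. by move=> -> ->. Qed.

Lemma shriek_ins_out p q r a (x : P q a) :
  (0 < p)%N -> shriek_ins p r x = 0.
Proof. by case: p. Qed.

Lemma bx_eq0 p p' r r' q a (x : P q a) q' a' (y : P q' a') :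
  p = p' -> r = r' -> op_eq x y ->
  @bx_eq k shriek_mod p q r a 0 p' q' r' a' 0.
Proof. by move=> <- <- xy; case: _ _ _ / xy. Qed.

Lemma ord_hi n (i : 'I_n.+1) : i <> ord0 -> exists j, i = hi j.
Proof.
case: (unliftP ord0 i) => [j ->|->] // _; by exists j.
Qed.

Lemma shriek_muA p n r (ps : 'I_n.+1 -> nat) (qs : 'I_n -> nat) a b
      (x : shriek_mod p n r a)
      (xs : forall i, shriek_mod (ps (lo i)) (qs i) (ps (hi i)) (b i))
      (t : 'I_(\sum_i qs i).+1 -> nat) (w : 'I_(\sum_i qs i)%N -> nat) c
      (z : forall l, shriek_mod (t (lo l)) (w l) (t (hi l)) (c l))
      (zb : forall i (j : 'I_(qs i)),
        shriek_mod (t (cut qs i (lo j))) (w (tagnat.Rank i j))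
               (t (cut qs i (hi j))) (c (tagnat.Rank i j)))
      (T := fun i : 'I_n.+1 => (ps i + t (cut qs i 0))%N)
      (ys : forall i, shriek_mod (T (lo i)) (\sum_j w (tagnat.Rank i j))%N
                        (T (hi i)) (b i + \sum_j c (tagnat.Rank i j))) :
    (forall i j, bx_eq (zb i j) (z (tagnat.Rank i j))) ->
    (forall i, bx_eq (ys i)
       (@shriek_mu _ _ _ (fun j : 'I_(qs i).+1 => t (cut qs i j)) _ _ _
          (xs i) (zb i))) ->
    bx_eq (shriek_mu x ys) (shuffle_sign k b c *: shriek_mu (shriek_mu x xs) z).
Proof.
move=> zbz ysE.
have {}zbz i j : shriek_ext (zb i j) = shriek_ext (z (tagnat.Rank i j)).
  exact/op_eqE/bx_eq_shriek.
have {}ysE i := op_eqE (bx_eq_shriek (ysE i)).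
have A := ns_muA (shriek_ext x) (fun i => shriek_ext (xs i))
  (fun l => shriek_ext (z l)).
have T0 : T ord0 = (ps ord0 + t ord0)%N by rewrite /T cut_first.
have Tn : T ord_max = (ps ord_max + t ord_max)%N by rewrite /T cut_last.
have e0 : (p + T ord0)%N = (p + ps ord0 + t ord0)%N by rewrite T0 addnA.
have en : (r + T ord_max)%N = (r + ps ord_max + t ord_max)%N.
  by rewrite Tn addnA.
pose good := [&& p == 0%N, r == 0%N, [forall i, ps i == 0%N]
               & [forall l, t l == 0%N]].
have [/and4P[/eqP p0 /eqP r0 /forallP ps0 /forallP t0]|bad] := boolP good.
  have {}ps0 i : ps i = 0%N by apply/eqP.
  have {}t0 i : t i = 0%N by apply/eqP.
  rewrite /shriek_mu -shriek_insZ; apply: op_eq_shriek => //.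
  rewrite shriek_extK ?ps0 ?p0 ?r0 //.
  suff -> : (fun i => shriek_ext (ys i)) = (fun i => ns_mu (shriek_ext (xs i))
    (fun j => shriek_ext (z (tagnat.Rank i j)))) by exact: A.
  apply: functional_extensionality_dep => i.
  rewrite ysE shriek_extK ?ps0 ?t0 //.
  by congr ns_mu; apply: functional_extensionality_dep => j; rewrite zbz.
suff [-> ->] : shriek_mu x ys = 0 /\ shriek_mu (shriek_mu x xs) z = 0.
  by rewrite scaler0; exact: bx_eq0 A.
have out : (0 < p + T ord0)%N ->
    shriek_mu x ys = 0 /\ shriek_mu (shriek_mu x xs) z = 0.
  by move=> h; split; apply: shriek_ins_out; rewrite // -e0.
have zero : shriek_ext (shriek_mu x xs) = 0 ->
    shriek_mu (shriek_mu x xs) z = 0.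
  by move=> h; rewrite [LHS]/shriek_mu ns_mu0l // shriek_ins0.
have ext0 q a' p' r' : shriek_ext (0 : shriek_mod p' q r' a') = 0.
  by case: (p') (r') => [|?] [|?].
have [pr|] := posnP (p + r); last first.
  move=> pr; have x0 := shriek_ext0 x pr; split.
    by rewrite /shriek_mu ns_mu0l // shriek_ins0.
  by apply: zero; rewrite /shriek_mu ns_mu0l // shriek_ins0.
move: bad; rewrite /good; move/eqP: pr; rewrite addn_eq0 => /andP[-> ->] /=.
rewrite negb_and => /orP[] /forallPn[i].
  rewrite -lt0n => psi; have [i0|/eqP/ord_hi[j ij]] := eqVneq i ord0.
    by apply: out; rewrite T0 -i0 !addn_gt0 psi !orbT.
  split.
    rewrite /shriek_mu (@ns_mu0 _ _ _ _ _ _ j) ?shriek_ins0 //.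
    by apply: shriek_ext0; rewrite /T -ij !addn_gt0 psi !orbT.
  apply: zero; rewrite /shriek_mu (@ns_mu0 _ _ _ _ _ _ j) ?shriek_ins0 //.
  by apply: shriek_ext0; rewrite -ij addn_gt0 psi orbT.
rewrite -lt0n => ti; have [i0|/eqP/ord_hi[l il]] := eqVneq i ord0.
  by apply: out; rewrite T0 -i0 !addn_gt0 ti !orbT.
have zl : shriek_ext (z l) = 0.
  by apply: shriek_ext0; rewrite -il addn_gt0 ti orbT.
split; rewrite [LHS]/shriek_mu; last first.
  by rewrite (@ns_mu0 _ _ _ _ _ _ l) ?shriek_ins0.
rewrite (@ns_mu0 _ _ _ _ _ _ (tagnat.sig1 l)) ?shriek_ins0 //.
rewrite ysE /shriek_mu (@ns_mu0 _ _ _ _ _ _ (tagnat.sig2 l)) ?shriek_ins0 //.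
by rewrite zbz tagnat.sig2K.
Qed.

Lemma shriek_insK p q r a (x : shriek_mod p q r a) :
  shriek_ins p r (shriek_ext x) = x.
Proof. by case: p r x => [|p] [|r] x //=; rewrite [RHS]thinmx0. Qed.

(** When [p], [r] and all [ps i] are zero, [shriek_ins] and [shriek_ext] are
    identities and [shriek_mu] is the composition of [P]; otherwise the target
    or one of the arguments lies in a zero module and [shriek_mu] is zero. *)
Definition thin_shriek_ob : boxop k.
Proof.
exists shriek_mod (@shriek_mu) (ns_one P : shriek_mod 0 1 0 0).
- exact: shriek_muP.
- exact: ns_d1.
- move=> ps qs b xs; rewrite -[X in bx_eq _ X]shriek_insK.
  apply: op_eq_shriek; last exact: ns_mu1x.
  + by rewrite add0n; congr ps; apply: val_inj.
  + by rewrite add0n; congr ps; apply: val_inj.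
- move=> p n r a x; rewrite -[X in bx_eq _ X]shriek_insK.
  by apply: op_eq_shriek; rewrite ?addn0 //; exact: ns_mux1.
- exact: shriek_muA.
Defined.

End ThinShriek.

Section ThinShriekFunctor.
Variable k : fieldType.

Definition shriek_map (P Q : nsop k) (f : nsop_mor P Q) p q r a :
    shriek_mod P p q r a -> shriek_mod Q p q r a :=
  match p, r return shriek_mod P p q r a -> shriek_mod Q p q r a with
  | 0, 0 => f q a | _, _ => fun=> 0 end.

Lemma nsm0 (P Q : nsop k) (f : nsop_mor P Q) q a : f q a 0 = 0.
Proof.
have := nsm_linear f (-1) (0 : P q a) 0.
by rewrite scaler0 addr0 scaleN1r addNr.
Qed.

Lemma shriek_mapE (P Q : nsop k) (f : nsop_mor P Q) p q r a
    (x : shriek_mod P p q r a) :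
  shriek_map f x = shriek_ins p r (f q a (shriek_ext x)).
Proof. by case: p r x => [|p] [|r]. Qed.

Lemma shriek_ext_map (P Q : nsop k) (f : nsop_mor P Q) p q r a
    (x : shriek_mod P p q r a) :
  shriek_ext (shriek_map f x) = f q a (shriek_ext x).
Proof. by case: p r x => [|p] [|r] x //=; rewrite nsm0. Qed.

Definition thin_shriek_mor (P Q : nsop k) (f : nsop_mor P Q) :
  boxop_mor (thin_shriek_ob P) (thin_shriek_ob Q).
Proof.
exists (@shriek_map P Q f).
- by move=> p q r a c x y; rewrite !shriek_mapE shriek_ext_linear nsm_linear
    shriek_ins_linear.
- by move=> p q r a x; rewrite !shriek_mapE shriek_ext_d nsm_d shriek_ins_d.
- move=> p n r ps qs a b x xs.
  have -> : shriek_map f (bx_mu x xs) =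
    shriek_ins _ _ (f _ _ (ns_mu (shriek_ext x)
      (fun i => shriek_ext (xs i)))).
    rewrite /= /shriek_mu; case: (p + _)%N => [|?] //.
    by case: (r + _)%N.
  rewrite nsm_mu /= /shriek_mu shriek_ext_map; congr shriek_ins; congr ns_mu.
  by apply: functional_extensionality_dep => i; rewrite shriek_ext_map.
- exact: nsm_one.
Defined.

(** As [mu_p : B(0,0,0) -> B(p,0,p)] may be nonzero in a box operad but is zero
    in [thin_shriek P] for [p > 0], the coreflection of [B] is the suboperad of
    [thin_star B] that keeps, in arity 0, the elements killed by all [mu_p]. *)
Definition thin_shriek : functor (nsop_cat k) (boxop_cat k).
Proof.
exists (@thin_shriek_ob k : nsop_cat k -> boxop_cat k) thin_shriek_mor.
- by move=> P; apply: boxop_mor_eq => -[|p] q [|r] a x //=; rewrite [RHS]thinmx0.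
- by move=> P Q R f g; apply: boxop_mor_eq => -[|p] q [|r] a x.
Defined.

End ThinShriekFunctor.

(* Main.v *)
(** A morphism [f : thin_shriek P -> B] is determined by its components
    [P q -> B 0 q 0].  These form a morphism of operads, and the only further
    condition on them comes from the compositions with [n = 0]:
    [mu_p : B 0 0 0 -> B p 0 p] must vanish on [f (P 0)] for [p > 0], because
    [thin_shriek P] is zero in arity [(p, 0, p)].  For [n > 0] a nonzero colour
    forces an argument into a zero module.  So the elements killed by all these
    [mu_p] form a suboperad of [thin_star B], and it is the coreflection. *)

Require Import Defs.
From HB Require Import structures.
From mathcomp Require Import all_boot all_order all_algebra.
From mathcomp Require Import boolp.

Import GRing.Theory.
Local Open Scope ring_scope.

Set Implicit Arguments.
Unset Strict Implicit.
Unset Printing Implicit Defensive.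

(** * Coreflections from couniversal arrows *)

Section Couniversal.
Variables (D : category) (S : D -> Prop) (R : D -> D) (RS : forall Y, S (R Y)).
Variable eps : forall Y, mor (R Y) Y.
Hypothesis eps_couniv : forall X Y (f : mor X Y), S X ->
  exists g : mor X (R Y), mcomp (eps Y) g = f.
Hypothesis eps_mono : forall X Y (g h : mor X (R Y)), S X ->
  mcomp (eps Y) g = mcomp (eps Y) h -> g = h.

(** Choosing a factorization of each [f] through [eps Y] gives the adjunction bijection. As [eps Y]
    can be cancelled, functor laws and naturality are checked after composing with it. *)
Lemma coreflective_couniv : coreflective S.
Proof.
have lift (X : full_subcat S) Y :
    {phi : mor (sval X) Y -> mor (sval X) (R Y) &
      forall f, mcomp (eps Y) (phi f) = f}.
  apply: (@choice _ _ (fun f (g : mor (sval X) (R Y)) => mcomp (eps Y) g = f)) => f.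
  exact: eps_couniv (svalP X).
pose phi X Y := projT1 (lift X Y).
have phiK X Y f : mcomp (eps Y) (phi X Y f) = f := projT2 (lift X Y) f.
have mono (X : full_subcat S) Y (g h : mor (sval X) (R Y)) :
  mcomp (eps Y) g = mcomp (eps Y) h -> g = h := eps_mono (svalP X).
pose R0 Y : full_subcat S := exist S (R Y) (RS Y).
pose R1 Y Z (f : mor Y Z) : mor (R0 Y) (R0 Z) :=
  phi (R0 Y) Z (mcomp f (eps Y)).
have R11 Y : R1 Y Y (idm Y) = idm (R0 Y).
  by apply: (mono (R0 Y)); rewrite phiK comp1m compm1.
have R1M X Y Z (f : mor Y Z) (g : mor X Y) :
    R1 X Z (mcomp f g) = mcomp (R1 Y Z f) (R1 X Y g).
  apply: (mono (R0 X)); rewrite phiK [RHS]compmA [in RHS]phiK.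
  by rewrite -[RHS]compmA [in RHS]phiK compmA.
exists (@Functor D (full_subcat S) R0 R1 R11 R1M), phi; split.
- move=> X Y; exists (fun g => mcomp (eps Y) g) => [f|g]; first exact: phiK.
  by apply: mono; rewrite phiK.
- move=> X X' Y f h; apply: (mono X').
  by rewrite phiK [RHS]compmA phiK.
- move=> X Y Y' g h; apply: (mono X).
  by rewrite phiK [RHS]compmA [in RHS]phiK -[RHS]compmA phiK.
Qed.

End Couniversal.

(** * Equality with the identity functor *)

Definition mor_cast (C : category) (X X' Y Y' : C) (eX : X = X') (eY : Y = Y')
  (f : mor X Y) : mor X' Y' :=
  ecast Z (mor Z Y') eX (ecast Z (mor X Z) eY f).

(** Once the object map is rewritten to the identity, the casts run along proofs of [X = X], which
    proof irrelevance turns into [erefl]. *)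
Lemma functor_eq_id (C : category) (F : functor C C) (e : forall X, F X = X) :
  (forall X Y (f : mor X Y), mor_cast (e X) (e Y) (fmap F f) = f) ->
  F = functor_id C.
Proof.
case: F e => F0 F1 F11 F1M /= e F1E.
have F0E : F0 = fun X => X by apply: functional_extensionality_dep.
move: F1 F11 F1M e F1E; rewrite F0E => F1 F11 F1M e F1E.
have {F1E} F1E : F1 = fun _ _ f => f.
  do 3![apply: functional_extensionality_dep => ?].
  rewrite -[RHS]F1E.
  by rewrite (Prop_irrelevance (e _) erefl) (Prop_irrelevance (e _) erefl).
rewrite F1E in F11 F1M *; congr Functor; exact: Prop_irrelevance.
Qed.

(** * Submodules and suboperads *)

Section Submodule.
Variables (k : fieldType) (V : lmodType k).

Record submod := Submod {
  submod_pred :> V -> Prop;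
  submod0 : submod_pred 0;
  submodP : forall c x y, submod_pred x -> submod_pred y ->
    submod_pred (c *: x + y) }.

Variable S : submod.

(** Algebraic substructures are built on boolean predicates, hence the classical boolean form of
    [S]. *)
Definition submod_mem : {pred V} := fun x => `[< S x >].

Lemma submod_mem_closed : subsemimod_closed submod_mem.
Proof.
apply: GRing.submod_closed_semi; split=> [|c x y /asboolP Sx /asboolP Sy].
  by apply/asboolP; exact: submod0.
by apply/asboolP; exact: submodP.
Qed.

Record sub_of := SubOf { sub_val : V; sub_in : sub_val \in submod_mem }.

HB.instance Definition _ := [isSub for sub_val].
HB.instance Definition _ := [Choice of sub_of by <:].
HB.instance Definition _ :=
  GRing.SubChoice_isSubLmodule.Build k V submod_mem sub_of submod_mem_closed.

Definition to_sub x (Sx : S x) : sub_of := SubOf (asboolT Sx).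

Lemma sub_valP (x : sub_of) : S (sub_val x).
Proof. by case: x => x Sx; exact/asboolP. Qed.

Lemma sub_val_linear : linear sub_val.
Proof. by []. Qed.

End Submodule.

Section Suboperad.
Variables (k : fieldType) (P : nsop k).

Record subop := SubOp {
  subop_mod :> forall q a, submod (P q a);
  subop_d : forall q a (x : P q a), subop_mod q a x ->
    subop_mod q (a - 1) (dg_d _ x);
  subop_one : subop_mod 1%N 0 (ns_one P);
  subop_mu : forall n (qs : 'I_n -> nat) a b
    (x : P n a) (xs : forall i, P (qs i) (b i)),
    subop_mod n a x -> (forall i, subop_mod (qs i) (b i) (xs i)) ->
    subop_mod _ _ (ns_mu x xs) }.

Variable S : subop.

Definition sub_d q a (x : sub_of (S q a)) : sub_of (S q (a - 1)) :=
  to_sub (subop_d (sub_valP x)).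

Lemma sub_d_linear q a : linear (@sub_d q a).
Proof. by move=> c x y; apply: val_inj; rewrite /= !linearP. Qed.

HB.instance Definition _ q a :=
  GRing.isLinear.Build k (sub_of (S q a)) (sub_of (S q (a - 1))) *:%R
    (@sub_d q a) (@sub_d_linear q a).

Lemma sub_dd q a (x : sub_of (S q a)) : sub_d (sub_d x) = 0.
Proof. by apply: val_inj; rewrite /= dg_dd. Qed.

Definition sub_dgmod (q : nat) : dgmod k :=
  @DgMod k (fun a => sub_of (S q a)) (fun a => @sub_d q a) (@sub_dd q).

Definition subv q a : sub_dgmod q a -> P q a := @sub_val k _ (S q a).

Lemma subv_inj q a : injective (@subv q a).
Proof. exact: val_inj. Qed.

Lemma subv_linear q a : linear (@subv q a).
Proof. exact: sub_val_linear. Qed.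

HB.instance Definition _ q a :=
  GRing.isLinear.Build k (sub_dgmod q a) (P q a) *:%R
    (@subv q a) (@subv_linear q a).

Lemma subvP q a (x : sub_dgmod q a) : S q a (subv x).
Proof. exact: sub_valP. Qed.

Lemma subv_cast q a b (e : a = b) (x : sub_dgmod q a) :
  subv (dg_cast e x) = dg_cast e (subv x).
Proof. by case: b / e. Qed.

Definition sub_mu n (qs : 'I_n -> nat) :
    mmap (sub_dgmod n) (fun i => sub_dgmod (qs i)) (sub_dgmod (\sum_i qs i)%N) :=
  fun a b x xs => to_sub (subop_mu (subvP x) (fun i => subvP (xs i))).

Lemma subv_mu n (qs : 'I_n -> nat) a b
    (x : sub_dgmod n a) (xs : forall i, sub_dgmod (qs i) (b i)) :
  subv (sub_mu x xs) = ns_mu (subv x) (fun i => subv (xs i)).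
Proof. by []. Qed.

(** The inclusion [subv] is injective, linear and compatible with compositions and differentials, so
    each law is inherited from [P]. *)
Lemma sub_muP n (qs : 'I_n -> nat) : chain_mmap (@sub_mu n qs).
Proof.
have [lin0 lini dif] := ns_muP P qs.
split.
- move=> a b xs c x y; apply: subv_inj.
  by rewrite linearP !subv_mu linearP lin0.
- move=> a b x xs ys zs i c xyz zsi; apply: subv_inj.
  rewrite linearP !subv_mu; apply: lini (i) _ _ _ => [j /xyz [-> ->] //|].
  by rewrite zsi linearP.
- move=> a b x xs; apply: subv_inj.
  rewrite [LHS]dif linearD linear_sum; congr (_ + _).
    by rewrite [RHS]subv_cast.
  apply: eq_bigr => i _; rewrite linearZ; congr (_ *: _).
  rewrite [RHS]subv_cast; congr dg_cast; rewrite subv_mu.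
  congr ns_mu; apply: functional_extensionality_dep => j; rewrite /d_at.
  by case: eqP => _; rewrite ?subv_cast.
Qed.

Lemma op_eq_subv q a (x : sub_dgmod q a) q' a' (y : sub_dgmod q' a') :
  op_eq (subv x) (subv y) -> op_eq x y.
Proof.
(* Replacing [subv y] by an arbitrary [y'] lets [op_eq] be inverted over free indices. *)
pose R q' a' (y' : P q' a') := forall y, subv y = y' -> op_eq x y.
suff RP q1 a1 (y1 : P q1 a1) : op_eq (subv x) y1 -> R q1 a1 y1.
  by move=> /RP; apply.
by case=> z /subv_inj ->.
Qed.

Definition sub_nsop : nsop k.
Proof.
exists sub_dgmod sub_mu (to_sub (subop_one S)).
- exact: sub_muP.
- by apply: subv_inj; rewrite linear0; exact: ns_d1.
- by move=> qs b xs; apply: op_eq_subv; exact: ns_mu1x.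
- by move=> n a x; apply: op_eq_subv; exact: ns_mux1.
- move=> n qs a b x xs w c z; apply: op_eq_subv.
  by rewrite linearZ; exact: ns_muA.
Defined.

Definition sub_corestr (Q : nsop k) (f : nsop_mor Q P)
  (fS : forall q a (x : Q q a), S q a (f q a x)) : nsop_mor Q sub_nsop.
Proof.
exists (fun q a x => to_sub (fS q a x) : sub_nsop q a).
- by move=> q a c x y; apply: subv_inj; rewrite linearP; exact: nsm_linear.
- by move=> q a x; apply: subv_inj; exact: nsm_d.
- by move=> n qs a b x xs; apply: subv_inj; exact: nsm_mu.
- by apply: subv_inj; exact: nsm_one.
Defined.

End Suboperad.

(** * The coreflection of a box operad *)

Section BoxZero.
Variables (k : fieldType) (B : boxop k).

Lemma bx_mu0l p n r (ps : 'I_n.+1 -> nat) (qs : 'I_n -> nat) a b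
    (x : B p n r a) (xs : forall i, B (ps (lo i)) (qs i) (ps (hi i)) (b i)) :
  x = 0 -> bx_mu x xs = 0.
Proof.
move=> ->; have [lin0 _ _] := bx_muP B p r ps qs.
have /= := lin0 a b xs (-1) 0 0.
by rewrite scaler0 addr0 scaleN1r addNr.
Qed.

Lemma bx_mu0 p n r (ps : 'I_n.+1 -> nat) (qs : 'I_n -> nat) a b
    (x : B p n r a) (xs : forall i, B (ps (lo i)) (qs i) (ps (hi i)) (b i)) i :
  xs i = 0 -> bx_mu x xs = 0.
Proof.
move=> xi0; have [_ lini _] := bx_muP B p r ps qs.
have := @lini a b x xs xs xs i (-1) (fun _ _ => conj erefl erefl).
by rewrite xi0 scaler0 addr0 scaleN1r addNr => /(_ erefl).
Qed.

Lemma bx_eq0_inv p q r a p' q' r' a' (y : B p' q' r' a') :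
  bx_eq (0 : B p q r a) y -> y = 0.
Proof. by case. Qed.

Lemma bx_eq00 p p' q r r' a : p = p' -> r = r' ->
  bx_eq (0 : B p q r a) (0 : B p' q r' a).
Proof. by move=> <- <-. Qed.

Lemma bxm0 (C : boxop k) (f : boxop_mor B C) p q r a : f p q r a 0 = 0.
Proof.
have := bxm_linear f (-1) (0 : B p q r a) 0.
by rewrite scaler0 addr0 scaleN1r addNr.
Qed.

End BoxZero.

Arguments bx_mu0 {k B p n r ps qs a b x xs} i.

Lemma shriek_ext00 (k : fieldType) (P : nsop k) p q r a :
  shriek_ext (0 : shriek_mod P p q r a) = 0.
Proof. by case: p r => [|p] [|r]. Qed.

Section Core.
Variables (k : fieldType) (B : boxop k).

(* The arity is kept as a variable [q] with hypothesis [q = 0], so that the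
   condition is void in positive arities and needs no case analysis on [q]. *)
Definition mu_killed q a (x : B 0 q 0 a) : Prop :=
  q = 0%N -> forall (ps : 'I_q.+1 -> nat) (qs : 'I_q -> nat) b
    (xs : forall i, B (ps (lo i)) (qs i) (ps (hi i)) (b i)),
  (0 < ps ord0)%N -> bx_mu x xs = 0.

Definition mu_killed_submod q a : submod (B 0 q 0 a).
Proof.
exists (@mu_killed q a).
- by move=> _ ps qs b xs _; exact: bx_mu0l.
- move=> c x y Kx Ky q0 ps qs b xs ps0.
  have [lin0 _ _] := bx_muP B 0 0 ps qs.
  by rewrite lin0 Kx // Ky // scaler0 addr0.
Defined.

Lemma mu_killed_d q a (x : B 0 q 0 a) : mu_killed x -> mu_killed (dg_d _ x).
Proof.
move=> Kx q0; subst q => ps qs b xs ps0.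
have [_ _ dif] := bx_muP B 0 0 ps qs.
(* With no inputs the chain rule says that mu_p commutes with the differential, up to a degree
   cast. *)
have := dif a b x xs; rewrite [X in _ = _ + X]big_ord0 addr0 Kx // linear0.
by case: _ / (deg_d0 _ _).
Qed.

(* Associativity rewrites [mu_p (mu (x; x_1, ..., x_n))] as
   [mu (x; mu_p x_1, ..., mu_p x_n)], or as [mu_p x] when [n = 0]. *)
Lemma mu_killed_mu n (qs : 'I_n -> nat) a b (x : B 0 n 0 a)
    (xs : forall i, B 0 (qs i) 0 (b i)) :
  mu_killed x -> (forall i, mu_killed (xs i)) ->
  mu_killed (@bx_mu k B 0 n 0 (fun=> 0%N) qs a b x xs).
Proof.
move=> Kx Kxs qs0 t w c z t0.
have {}qs0 i : qs i = 0%N.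
  by apply/eqP; move/eqP: qs0; rewrite sum_nat_eq0 => /forallP /(_ i).
(* All [qs i] vanish, so the outer composite has a single colour, positive by [t0]. *)
have all0 (l : 'I_(\sum_i qs i).+1) : l = ord0.
  apply: val_inj => /=; apply/eqP; rewrite -leqn0 -ltnS.
  by rewrite (leq_trans (ltn_ord l)) // ltnS big1.
have t_gt0 l : (0 < t l)%N by rewrite (all0 l).
have zb i (j : 'I_(qs i)) :
    B (t (cut qs i (lo j))) (w (tagnat.Rank i j)) (t (cut qs i (hi j)))
      (c (tagnat.Rank i j)).
  by have := ltn_ord j; rewrite [X in (_ < X)%N]qs0.
pose T := fun i : 'I_n.+1 => (0 + t (cut qs i 0))%N.
(* Each [xs i] is killed, so its composite with its empty block of inputs is zero. *)
pose ys i : B (T (lo i)) (\sum_j w (tagnat.Rank i j))%N (T (hi i))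
  (b i + \sum_j c (tagnat.Rank i j)) := 0.
have A := @bx_muA k B 0 n 0 (fun=> 0%N) qs a b x xs t w c z zb ys.
(* For [n = 0] this is the hypothesis on [x]; for [n > 0] an argument is zero. *)
have ys0 : bx_mu x ys = 0.
  case: (posnP n) => [n0|n_gt0]; first by apply: Kx => //; rewrite /T add0n.
  exact: (bx_mu0 (Ordinal n_gt0)).
have {}A : shuffle_sign k b c *:
    bx_mu (@bx_mu k B 0 n 0 (fun=> 0%N) qs a b x xs) z = 0.
  rewrite ys0 in A; apply: bx_eq0_inv (A _ _).
    by move=> i j; have := ltn_ord j; rewrite [X in (_ < X)%N]qs0.
  move=> i; rewrite (Kxs i (qs0 i)) //.
  by apply: bx_eq00; rewrite /T ?(all0 (cut _ _ _)).
(* The Koszul sign is a power of -1, hence can be cancelled. *)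
apply/eqP; move/eqP: A; rewrite scaler_eq0 => /orP[|//].
by rewrite /shuffle_sign expfz_eq0 oppr_eq0 oner_eq0 andbF.
Qed.

Definition core_subop : subop (thin_star_ob B).
Proof.
exists (@mu_killed_submod).
- exact: mu_killed_d.
(* The unit has arity 1, where [mu_killed] is void. *)
- by [].
- exact: mu_killed_mu.
Defined.

Definition core : nsop k := sub_nsop core_subop.

Definition core_counit_fun p q r a :
    thin_shriek_ob core p q r a -> B p q r a :=
  match p, r return thin_shriek_ob core p q r a -> B p q r a with
  | 0, 0 => @subv k _ core_subop q a | _, _ => fun=> 0 end.

Lemma core_counit_fun0 p q r a (x : thin_shriek_ob core p q r a) :
  shriek_ext x = 0 -> core_counit_fun x = 0.
Proof. by case: p r x => [|p] [|r] x //= ->; rewrite linear0. Qed.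

Definition core_counit : boxop_mor (thin_shriek_ob core) B.
Proof.
exists core_counit_fun.
- by move=> [|p] q [|r] a c x y; rewrite /= ?scaler0 ?addr0.
- by move=> [|p] q [|r] a x; rewrite /= ?linear0.
- move=> p n r ps qs a b x xs.
  have [pr0|pr] := posnP (p + r); last first.
    have x0 : shriek_ext x = 0 := shriek_ext0 x pr.
    rewrite [RHS]bx_mu0l ?core_counit_fun0 //= /shriek_mu.
    by rewrite ns_mu0l // shriek_ins0 shriek_ext00.
  move/eqP: pr0; rewrite addn_eq0 => /andP[/eqP p0 /eqP r0]; subst p r.
  have [/forallP ps0|/forallPn[i]] := boolP [forall i, ps i == 0%N].
    have {}ps0 : ps = fun=> 0%N.
      by apply: functional_extensionality_dep => i; apply/eqP.
    by subst ps.
  rewrite -lt0n => psi; have [n0|n_gt0] := posnP n.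
    (* The left side comes from a zero module; the right side is mu_p of an element of the core,
       with [p = ps ord0 > 0]. *)
    subst n; rewrite (ord1 i) in psi; rewrite [LHS]core_counit_fun0.
      by apply/esym; exact: (subvP (S := core_subop) x).
    by apply: shriek_ext0; rewrite addn_gt0 add0n psi.
  (* For [n > 0] every colour borders some input, so a nonzero colour puts that input in a zero
     module. *)
  have [j psj] : exists j : 'I_n, (0 < ps (lo j) + ps (hi j))%N.
    have [i0|/eqP/ord_hi[j ij]] := eqVneq i ord0; last first.
      by exists j; rewrite -ij addn_gt0 psi orbT.
    exists (Ordinal n_gt0); rewrite (_ : lo _ = i) ?addn_gt0 ?psi // i0.
    exact: val_inj.
  have xj0 : shriek_ext (xs j) = 0 := shriek_ext0 (xs j) psj.
  rewrite [RHS](bx_mu0 j) ?core_counit_fun0 //= /shriek_mu.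
  by rewrite (ns_mu0 _ (i := j)) // shriek_ins0 shriek_ext00.
- by [].
Defined.

Lemma core_counit_inj p q r a : injective (core_counit p q r a).
Proof.
case: p r => [|p] [|r] x y; first exact: (@subv_inj _ _ core_subop q a x y).
all: by move=> _; rewrite [x]thinmx0 [y]thinmx0.
Qed.

(** [f] commutes with mu_p, and for [p > 0] its source is zero in arity [(p, 0, p)]. *)
Lemma thin_shriek_killed (P : nsop k) (f : boxop_mor (thin_shriek_ob P) B)
    q a (x : P q a) :
  mu_killed (f 0%N q 0%N a (x : thin_shriek_ob P 0 q 0 a)).
Proof.
move=> q0; subst q => ps qs b xs ps0.
(* The family of inputs is empty, so the zero family lifts it along [f]. *)
pose xs' i : thin_shriek_ob P (ps (lo i)) (qs i) (ps (hi i)) (b i) := 0.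
have -> : xs = fun i => f _ _ _ _ (xs' i).
  by apply: functional_extensionality_dep => -[].
rewrite -bxm_mu -[RHS](bxm0 f); congr (f _ _ _ _).
by apply: shriek_ins_out; rewrite add0n.
Qed.

(** The components of [f] in arities [(0, q, 0)] form an operad morphism [f0] that lands in the
    core; its corestriction induces [g]. In the other arities the source is zero. *)
Lemma core_couniv (P : nsop k) (f : boxop_mor (thin_shriek_ob P) B) :
  exists g : boxop_mor (thin_shriek_ob P) (thin_shriek_ob core),
    boxop_comp core_counit g = f.
Proof.
pose f0 := @NsOpMor k P (thin_star_ob B)
  (fun q a (x : P q a) => f 0%N q 0%N a x)
  (fun q a => @bxm_linear _ _ _ f 0 q 0 a) (fun q a => @bxm_d _ _ _ f 0 q 0 a)
  (fun n qs => @bxm_mu _ _ _ f 0 n 0 (fun=> 0%N) qs) (bxm_one f).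
exists (thin_shriek_mor (sub_corestr (S := core_subop) (f := f0)
  (@thin_shriek_killed P f))).
apply: boxop_mor_eq => p q r a x.
by case: p r x => [|p] [|r] x //=; rewrite [x]thinmx0 [RHS]bxm0.
Qed.

End Core.

(** * Thin operads *)

Section ThinStarShriek.
Variable k : fieldType.

Lemma thin_star_shriek_ob (P : nsop k) : thin_star_ob (thin_shriek_ob P) = P.
Proof.
case: P => m mu one *; rewrite /thin_star_ob /=; congr NsOp;
  exact: Prop_irrelevance.
Qed.

(* [thin_star (thin_shriek P)] and [P] have convertible data and differ only in
   their proofs, so in the only use of this lemma [eT] is [erefl]. *)
Lemma nsop_mor_cast (P P' Q Q' : nsop k) (eP : P' = P) (eQ : Q' = Q)
    (f' : nsop_mor P' Q') (f : nsop_mor P Q)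
    (eT : (forall q a, P' q a -> Q' q a) = (forall q a, P q a -> Q q a)) :
  ecast T T eT (@nsm k P' Q' f') = @nsm k P Q f ->
  @mor_cast (nsop_cat k) P' P Q' Q eP eQ f' = f.
Proof.
subst P' Q'; rewrite (Prop_irrelevance eT erefl) /= => f'f.
by apply: nsop_mor_eq => q a x; rewrite f'f.
Qed.

Lemma thin_star_shriek :
  functor_comp (thin_star k) (thin_shriek k) = functor_id (nsop_cat k).
Proof.
apply: (@functor_eq_id _ (functor_comp (thin_star k) (thin_shriek k))
  thin_star_shriek_ob) => P Q f.
exact: (@nsop_mor_cast P (thin_star_ob (thin_shriek_ob P)) Q
  (thin_star_ob (thin_shriek_ob Q)) _ _ (thin_star_mor (thin_shriek_mor f)) f
  erefl erefl).
Qed.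

Lemma thin_shriek_inj : injective (fob (thin_shriek k)).
Proof.
by move=> P Q /(congr1 (@thin_star_ob k)); rewrite /= !thin_star_shriek_ob.
Qed.

(** The inverse restricts a morphism to the arities [(0, q, 0)]; in all others the modules are
    zero. *)
Lemma thin_shriek_ff (P Q : nsop_cat k) :
  bijective (@fmap _ _ (thin_shriek k) P Q).
Proof.
pose unmap (f : boxop_mor (thin_shriek_ob P) (thin_shriek_ob Q)) :=
  @NsOpMor k P Q (fun q a (x : P q a) => f 0%N q 0%N a x)
  (fun q a => @bxm_linear _ _ _ f 0 q 0 a) (fun q a => @bxm_d _ _ _ f 0 q 0 a)
  (fun n qs => @bxm_mu _ _ _ f 0 n 0 (fun=> 0%N) qs) (bxm_one f).
exists unmap => f; first exact: nsop_mor_eq.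
apply: boxop_mor_eq => -[|p] q [|r] a x //=.
all: by rewrite [RHS]thinmx0.
Qed.

End ThinStarShriek.

Theorem proposition2p19 (k : fieldType) (char0 : [pchar k] =i pred0) :
  functor_comp (thin_star k) (thin_shriek k) = functor_id (nsop_cat k) /\
  embeds_as_coreflective (thin_shriek k).
Proof.
split; first exact: thin_star_shriek.
split; [exact: thin_shriek_inj | exact: thin_shriek_ff |].
(* The couniversal arrow to [B] is [core_counit B]; being injective in every arity and degree, it is
   monic. *)
apply: (@coreflective_couniv (boxop_cat k) _
  (fun B => thin_shriek k (core B)) _ (@core_counit k)).
- by move=> B; exists (core B).
- by move=> X B f [P XE]; subst X; exact: core_couniv.
- move=> X B g h _ gh; apply: boxop_mor_eq => p q r a x.
  apply: core_counit_inj.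
  exact: (congr1 (fun f : boxop_mor X B => f p q r a x) gh).
Qed.
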